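(* Let $B$ be a functionally graded elastic fluid with material form $\rho$, and suppose $B$ is unisymmetric. Let $\mathcal N(B)$ be the FGM material groupoid of $B$, $\mathcal U(B)$ the unimodular groupoid associated with $\rho$, and $\mathcal N^1(B)$ the unimodular reduction of $\mathcal N(B)$. Then $$\mathcal N^1(B)=\mathcal N(B)\cap\mathcal U(B).$$
   Context: The body $B$ is a smooth 3-dimensional manifold that can be embedded in $\mathbb R^3$; a (local) configuration is an embedding $K$ of (an open subset of) $B$ into $\mathbb R^3$. $B$ is elastic: it has a constitutive law $\sigma=\sigma(F,X)$, where $X\in B$ and $F:T_XB\to\mathbb R^3$ is a linear isomorphism. The symmetry group at $X$ is $\mathcal G(X)=\{P\in\mathrm{Gl}(T_XB):\sigma(F\cdot P,X)=\sigma(F,X)\ \text{for all }F\}$; in a configuration $K$ it is represented by $\mathcal G_K(X)=T_XK\cdot\mathcal G(X)\cdot(T_XK)^{-1}\subset\mathrm{Gl}(3)$. The frame groupoid is $\Pi(B)=\bigcup_{X,Y\in B}\mathrm{Iso}(T_XB,T_YB)$ with source $\alpha$ and target $\beta$. The FGM material groupoid is $\mathcal N(B)=\{A\in\Pi(B):\mathcal G(Y)=A\cdot\mathcal G(X)\cdot A^{-1},\ X=\alpha(A),\ Y=\beta(A)\}$. $B$ is unisymmetric if $\mathcal N(B)$ is transitive, i.e. for all $X,Y\in B$ it contains an element with source $X$ and target $Y$. For a volume form $\rho$ on $B$ and $A\in\Pi(B)$, the number $\det_\rho(A)$ is defined by $\rho(Av_1,Av_2,Av_3)=\det_\rho(A)\,\rho(v_1,v_2,v_3)$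 for $v_1,v_2,v_3\in T_{\alpha(A)}B$. The unimodular groupoid is $\mathcal U(B)=\{A\in\Pi(B):\det_\rho(A)\in\{-1,+1\}\}$. The unimodular reduction of a subgroupoid $\Omega\subset\Pi(B)$ is $\Omega^1=\{\,|\det_\rho(A)|^{-1/3}A : A\in\Omega\,\}$. Let $U(3)=\{A\in\mathrm{Gl}(3):\det A=\pm1\}$. A point $X\in B$ is an elastic fluid point if there is a configuration $K$ such that $\mathcal G_K(X)$ is a subgroup of $U(3)$ having $O(3)$ as a proper subgroup. $B$ is a functionally graded fluid if every point is an elastic fluid point and there is a volume form $\rho$ on $B$ (called a material form) invariant under material symmetries, in the sense that $\det_\rho(P)=\pm1$ for all $P\in\mathcal G(X)$, $X\in B$. *)

(* Defs.v *)
From HB Require Import structures.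
From mathcomp Require Import all_boot all_order all_algebra.
From mathcomp Require Import all_classical all_reals all_analysis.
Import Order.TTheory GRing.Theory Num.Theory.
Import numFieldNormedType.Exports.
Set Implicit Arguments.
Unset Strict Implicit.
Unset Printing Implicit Defensive.
Local Open Scope classical_set_scope.
Local Open Scope ring_scope.

Notation R3 R := ('rV[R]_3).

Record liso (R : pzRingType) (V W : lmodType R) := Liso {
  liso_fun :> V -> W;
  liso_linear : linear liso_fun;
  liso_bij : bijective liso_fun }.

Section LinearIso.
Variable R : pzRingType.

HB.instance Definition _ (V W : lmodType R) (f : liso V W) :=
  GRing.isLinear.Build R V W *:%R f (liso_linear f).

Lemma lisoP (V W : lmodType R) (f g : liso V W) : f =1 g -> f = g.
Proof.
case: f g => [f lf bf] [g lg bg] /= /funext fg; subst g.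
by rewrite (Prop_irrelevance lf lg) (Prop_irrelevance bf bg).
Qed.

Lemma id_linear (V : lmodType R) : linear (@idfun V).
Proof. by []. Qed.

Lemma id_bij (V : lmodType R) : bijective (@idfun V).
Proof. by exists idfun. Qed.

Definition liso_id (V : lmodType R) : liso V V :=
  Liso (@id_linear V) (@id_bij V).

Lemma comp_linear (U V W : lmodType R) (f : liso V W) (g : liso U V) :
  linear (f \o g).
Proof. by move=> a u v; rewrite /= !linearP. Qed.

Definition liso_comp (U V W : lmodType R) (f : liso V W) (g : liso U V) :
  liso U W := Liso (comp_linear f g) (bij_comp (liso_bij f) (liso_bij g)).

Lemma liso_inv_ex (V W : lmodType R) (f : liso V W) :
  exists g : W -> V, cancel f g /\ cancel g f.
Proof. by have [g fg gf] := liso_bij f; exists g. Qed.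

Definition liso_invfun (V W : lmodType R) (f : liso V W) : W -> V :=
  projT1 (cid (liso_inv_ex f)).

Lemma liso_invfunK (V W : lmodType R) (f : liso V W) :
  cancel f (liso_invfun f) /\ cancel (liso_invfun f) f.
Proof. exact: projT2 (cid (liso_inv_ex f)). Qed.

Lemma liso_inv_linear (V W : lmodType R) (f : liso V W) :
  linear (liso_invfun f).
Proof. by have [] := liso_invfunK f; apply: can2_linear. Qed.

Lemma liso_inv_bij (V W : lmodType R) (f : liso V W) :
  bijective (liso_invfun f).
Proof. by have [fg gf] := liso_invfunK f; exists f. Qed.

Definition liso_inv (V W : lmodType R) (f : liso V W) : liso W V :=
  Liso (@liso_inv_linear V W f) (@liso_inv_bij V W f).

Definition liso_conj (V W : lmodType R) (A : liso V W) (P : liso V V) :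
  liso W W := liso_comp A (liso_comp P (liso_inv A)).

Definition is_group (V : lmodType R) (H : set (liso V V)) : Prop :=
  [/\ H (liso_id V),
      forall P Q, H P -> H Q -> H (liso_comp P Q) &
      forall P, H P -> H (liso_inv P)].

Definition subgroup (V : lmodType R) (H G : set (liso V V)) : Prop :=
  [/\ is_group H, is_group G & H `<=` G].

End LinearIso.

Section Gl3.
Variable R : realType.

Definition Gl3 := liso (R3 R) (R3 R).

(* The matrix of [A] acts on row vectors, so it is the transpose of the usual
   one; this affects neither of the two conditions below. *)
Definition Gl3_mx (A : Gl3) : 'M[R]_3 := lin1_mx A.

Definition U3 : set Gl3 :=
  [set A | \det (Gl3_mx A) = 1 \/ \det (Gl3_mx A) = -1].

Definition O3 : set Gl3 := [set A | Gl3_mx A *m (Gl3_mx A)^T = 1%:M].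

End Gl3.

(* C^k on an open set, via iterated directional derivatives. *)
Fixpoint Ck (R : realType) (V W : normedModType R) (k : nat) (U : set V)
    (f : V -> W) : Prop :=
  match k with
  | 0 => forall x, U x -> {for x, continuous f}
  | k'.+1 => (forall x, U x -> differentiable f x) /\
             (forall v, Ck k' U (fun x => 'D_v f x))
  end.

Definition smooth_on (R : realType) (V W : normedModType R) (U : set V)
  (f : V -> W) : Prop := forall k, Ck k U f.

(* Only the values of [chart_map] on [chart_dom], and those of [chart_inv] on
   the image of [chart_dom], are meaningful. *)
Record chart (R : realType) (M : topologicalType) := Chart {
  chart_dom : set M;
  chart_map :> M -> R3 R;
  chart_inv : R3 R -> M;
  chart_dom_open : open chart_dom;
  chart_img_open : open (chart_map @` chart_dom);
  chart_continuous :
    forall x, chart_dom x -> {for x, continuous chart_map};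
  chart_inv_continuous :
    forall x, chart_dom x -> {for chart_map x, continuous chart_inv};
  chartK : forall x, chart_dom x -> chart_inv (chart_map x) = x }.

Record manifold (R : realType) := Manifold {
  carrier :> topologicalType;
  manifold_hausdorff : hausdorff_space carrier;
  manifold_second_countable : @second_countable carrier;
  atlas : set (chart R carrier);
  atlas_cover : forall x, exists2 c, atlas c & chart_dom c x;
  atlas_smooth : forall c c', atlas c -> atlas c' ->
    smooth_on (c @` (chart_dom c `&` chart_dom c')) (c' \o chart_inv c) }.

Record chart_at (R : realType) (M : manifold R) (x : M) := ChartAt {
  chart_of :> chart R M;
  chart_of_atlas : atlas chart_of;
  chart_of_dom : chart_dom chart_of x }.

Section Tangent.
Variables (R : realType) (M : manifold R).
Implicit Type x : M.

(* A tangent vector at [x] is the family of its coordinate vectors in the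
   charts around [x], related by the differentials of the changes of chart. *)
Definition compatible (x : M) : {pred (chart_at x -> R3 R)} := fun v =>
  `[< forall c c' : chart_at x, v c' = 'd (c' \o chart_inv c) (c x) (v c) >].
Arguments compatible : clear implicits.

Record tangent (x : M) := Tangent {
  coord : chart_at x -> R3 R;
  coord_compatible : coord \in compatible x }.

Lemma compatible_submod x : submod_closed (compatible x).
Proof.
split=> [|a u v]; first by apply/asboolP => c c'; rewrite linear0.
move=> /asboolP hu /asboolP hv; apply/asboolP => c c'.
by rewrite linearP -hu -hv.
Qed.

HB.instance Definition _ x :=
  GRing.isSubmodClosed.Build R (chart_at x -> R3 R) (compatible x)
    (compatible_submod x).
HB.instance Definition _ x := [isSub for @coord x].
HB.instance Definition _ x := [Choice of tangent x by <:].
HB.instance Definition _ x := [SubChoice_isSubLmodule of tangent x by <:].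

Lemma chart_at_ex x : exists c : chart_at x, True.
Proof. by have [c ca cx] := atlas_cover x; exists (ChartAt ca cx). Qed.

Definition some_chart x : chart_at x := projT1 (cid (chart_at_ex x)).

Lemma near_chart x (c c' : chart_at x) :
  \forall y \near c x, (c @` (chart_dom c `&` chart_dom c')) y.
Proof.
have h1 : nbhs (c x) (c @` chart_dom c).
  apply: open_nbhs_nbhs; split; first exact: chart_img_open.
  by exists x => //; exact: chart_of_dom.
have h2 : \forall y \near c x, chart_dom c' (chart_inv c y).
  apply: (chart_inv_continuous (chart_of_dom c)).
  rewrite chartK; last exact: chart_of_dom.
  apply: open_nbhs_nbhs; split; first exact: chart_dom_open.
  exact: chart_of_dom.
near=> y.
have [z cz zy] : (c @` chart_dom c) y by near: y.
exists z => //; split=> //.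
by rewrite -[z](chartK cz) zy; near: y.
Unshelve. all: by end_near. Qed.

Lemma transition_differentiable x (c c' : chart_at x) :
  differentiable (c' \o chart_inv c) (c x).
Proof.
have [+ _] := atlas_smooth (chart_of_atlas c) (chart_of_atlas c') 1.
apply; exists x => //; split; exact: chart_of_dom.
Qed.

Lemma near_eq_diff (V W : normedModType R) (f g : V -> W) (a : V) :
  differentiable f a -> differentiable g a -> (\near a, f a = g a) ->
  'd f a =1 'd g a.
Proof.
move=> df dg fg v; rewrite -!deriveE//.
have [->|v0] := eqVneq v 0; first by rewrite !deriveE// !linear0.
exact: near_eq_derive.
Qed.

Lemma diff_comp_at (U V W : normedModType R) (f : U -> V) (g : V -> W)
    (a : U) (b : V) (e : U) :
  f a = b -> differentiable f a -> differentiable g b ->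
  'd (g \o f) a e = 'd g b ('d f a e).
Proof. by move=> <- df dg; rewrite diff_comp. Qed.

Lemma lift_compatible x (c : chart_at x) (e : R3 R) :
  (fun c' : chart_at x => 'd (c' \o chart_inv c) (c x) e) \in compatible x.
Proof.
apply/asboolP => c1 c2.
have d1 := transition_differentiable c c1.
have d2 := transition_differentiable c1 c2.
have E : (c1 \o chart_inv c) (c x) = c1 x.
  by rewrite /= chartK//; exact: chart_of_dom.
refine (etrans _ (diff_comp_at e E d1 d2)); apply: near_eq_diff.
- exact: transition_differentiable.
- by apply: differentiable_comp => //; rewrite E.
near=> y => /=.
have [z [cz c1z] <-] : (c @` (chart_dom c `&` chart_dom c1)) y.
  by near: y; exact: near_chart.
by rewrite !chartK.
Unshelve. all: by end_near. Qed.

Definition lift x (c : chart_at x) (e : R3 R) : tangent x :=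
  Tangent (lift_compatible c e).

Lemma coord_lift x (c : chart_at x) (e : R3 R) : coord (lift c e) c = e.
Proof.
have iddiff : is_diff (c x) (@idfun (R3 R)) idfun by exact: is_diff_id.
have idE : 'd (@idfun (R3 R)) (c x) e = e by rewrite diff_val.
refine (etrans _ idE); apply: near_eq_diff.
- exact: transition_differentiable.
- exact: ex_diff.
near=> y => /=.
have [z [cz _] <-] : (c @` (chart_dom c `&` chart_dom c)) y.
  by near: y; exact: near_chart.
by rewrite chartK.
Unshelve. all: by end_near. Qed.

Lemma coord_inj x (c : chart_at x) (u v : tangent x) :
  coord u c = coord v c -> u = v.
Proof.
move=> uv; apply: val_inj => /=; apply/funext => c'.
have /asboolP uc := coord_compatible u; have /asboolP vc := coord_compatible v.
by rewrite (uc c c') (vc c c') uv.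
Qed.

(* [d/dx_i] at [x] in the chart [c]. *)
Definition partial_vec x (c : chart_at x) (i : 'I_3) : tangent x :=
  lift c (delta_mx 0 i).

(* The tangent map at [x] of a map into R^3 defined near [x], computed in some
   chart around [x]. *)
Definition tangent_map (f : M -> R3 R) x (v : tangent x) : R3 R :=
  let c := some_chart x in 'd (f \o chart_inv c) (c x) (coord v c).

Lemma tangent_map_linear (f : M -> R3 R) x : linear (@tangent_map f x).
Proof. by move=> a u v; rewrite /tangent_map /= linearP. Qed.

Lemma tangent_map_bij (f : M -> R3 R) x :
  injective (@tangent_map f x) -> bijective (@tangent_map f x).
Proof.
set c := some_chart x => fI.
pose g : {linear R3 R -> R3 R} := 'd (f \o chart_inv c) (c x).
have gE e : tangent_map f (lift c e) = e *m lin1_mx g.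
  by rewrite mul_rV_lin1 /tangent_map -/c coord_lift.
have gI : row_free (lin1_mx g).
  apply/inj_row_free => e; rewrite -gE => e0.
  have : lift c e = lift c 0.
    by apply: fI; rewrite e0 gE mul0mx.
  by move/(congr1 (fun v => coord v c)); rewrite !coord_lift.
exists (fun w => lift c (w *m invmx (lin1_mx g))) => [v|w].
  apply: fI; rewrite gE mulmxKV// -row_free_unit//.
by rewrite gE mulmxKV// -row_free_unit.
Qed.

End Tangent.

Record is_embedding (R : realType) (M : manifold R) (U : set M)
    (f : M -> R3 R) : Prop := IsEmbedding {
  embedding_open : open U;
  embedding_smooth : forall c, atlas c ->
    smooth_on (c @` (chart_dom c `&` U)) (f \o chart_inv c);
  embedding_immersion : forall x, U x -> injective (@tangent_map R M f x);
  embedding_inj : set_inj U f;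
  (* [f] is open from [U] onto its image (it is continuous by smoothness). *)
  embedding_homeo : forall V : set M, open V -> V `<=` U ->
    exists2 W : set (R3 R), open W & f @` V = W `&` f @` U }.

Record body (R : realType) := Body {
  body_manifold :> manifold R;
  body_embeddable : exists f, @is_embedding R body_manifold setT f }.

Record configuration (R : realType) (B : body R) := Configuration {
  conf_dom : set B;
  conf_map :> B -> R3 R;
  conf_embedding : is_embedding conf_dom conf_map }.

Definition conf_tangent (R : realType) (B : body R) (K : configuration B)
    (X : B) (hX : conf_dom K X) : liso (tangent X) (R3 R) :=
  Liso (@tangent_map_linear R B K X)
    (tangent_map_bij (embedding_immersion (conf_embedding K) hX)).

Record volume_form (R : realType) (M : manifold R) := VolumeForm {
  vol :> forall x : M, tangent x -> tangent x -> tangent x -> R;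
  vol_linear1 : forall x v w, scalar (fun u => @vol x u v w);
  vol_linear2 : forall x u w, scalar (fun v => @vol x u v w);
  vol_linear3 : forall x u v, scalar (fun w => @vol x u v w);
  vol_alternating : forall x u v w,
    u = v \/ v = w \/ u = w -> @vol x u v w = 0;
  vol_nonzero : forall x, exists u v w, @vol x u v w != 0;
  vol_smooth : forall c, atlas c ->
    exists2 h : R3 R -> R, smooth_on (c @` chart_dom c) h &
      forall (x : M) (cx : chart_at x), chart_of cx = c ->
        @vol x (partial_vec cx 0) (partial_vec cx 1) (partial_vec cx 2) =
        h (c x) }.

Record frame (R : realType) (M : manifold R) := Frame {
  source : M;
  target : M;
  frame_iso :> liso (tangent source) (tangent target) }.

Definition transitive_groupoid (R : realType) (M : manifold R)
    (Omega : set (frame M)) : Prop :=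
  forall X Y : M, exists A, [/\ Omega A, source A = X & target A = Y].

Section Unimodular.
Variables (R : realType) (M : manifold R) (rho : volume_form M).

(* The unique [d] in this set, tangent spaces being 3-dimensional. *)
Definition det_form (A : frame M) : R :=
  xget 0 [set d : R | forall v1 v2 v3 : tangent (source A),
    rho (target A) (A v1) (A v2) (A v3) = d * rho (source A) v1 v2 v3].

Definition unimodular_groupoid : set (frame M) :=
  [set A | det_form A = -1 \/ det_form A = 1].

(* Stated pointwise because [liso] has no scaling by a possibly zero factor;
   the factor [|det A|^(-1/3)] is nonzero, so no frame is lost. *)
Definition unimodular_reduction (Omega : set (frame M)) : set (frame M) :=
  [set P | exists2 A : liso (tangent (source P)) (tangent (target P)),
    Omega (Frame A) &
    forall v, P v = (`|det_form (Frame A)| `^ (- 3^-1)) *: A v].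

End Unimodular.

(* [S] is the space of values of the stress. *)
Definition constitutive_law (R : realType) (B : body R) (S : Type) :=
  forall X : B, liso (tangent X) (R3 R) -> S.

Section Elastic.
Variables (R : realType) (B : body R) (S : Type).
Variable sigma : constitutive_law B S.

Definition symmetry_group (X : B) : set (liso (tangent X) (tangent X)) :=
  [set P | forall F : liso (tangent X) (R3 R),
    sigma (liso_comp F P) = sigma F].
Arguments symmetry_group : clear implicits.

Definition symmetry_group_in (K : configuration B) (X : B)
    (hX : conf_dom K X) : set (Gl3 R) :=
  liso_conj (conf_tangent hX) @` symmetry_group X.

Definition material_groupoid : set (frame B) :=
  [set A | symmetry_group (target A) =
           liso_conj A @` symmetry_group (source A)].

Definition unisymmetric : Prop := transitive_groupoid material_groupoid.

Definition elastic_fluid_point (X : B) : Prop :=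
  exists (K : configuration B) (hX : conf_dom K X),
    let GK := symmetry_group_in hX in
    [/\ subgroup GK (@U3 R), subgroup (@O3 R) GK & @O3 R <> GK].

Definition material_form (rho : volume_form B) : Prop :=
  forall (X : B) (P : liso (tangent X) (tangent X)), symmetry_group X P ->
    det_form rho (Frame P) = 1 \/ det_form rho (Frame P) = -1.

Definition functionally_graded_fluid : Prop :=
  (forall X : B, elastic_fluid_point X) /\
  exists rho : volume_form B, material_form rho.

End Elastic.

(* Main.v *)
(* Conjugation by an isomorphism is unchanged when the isomorphism is rescaled,
   so the unimodular reduction of a material isomorphism is again a material
   isomorphism, and its determinant is normalised to 1 or -1.  Conversely a
   frame of determinant 1 or -1 is its own reduction. *)

Require Import Defs.
From mathcomp Require Import all_boot all_order all_algebra.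
From mathcomp Require Import all_classical all_reals all_analysis.
Local Open Scope classical_set_scope.
Import Order.TTheory GRing.Theory Num.Theory.
Local Open Scope ring_scope.

Lemma scalar_scale {R : pzRingType} {V : lmodType R} {f : V -> R} a u :
  scalar f -> f (a *: u) = a * f u.
Proof.
move=> lf; have f0 : f 0 = 0.
  by have := lf (-1) u u; rewrite scaleN1r mulN1r !addNr.
by have := lf a u 0; rewrite f0 !addr0.
Qed.

(** Writing [w] as [P (P^-1 w) = c *: A (P^-1 w)] gives [A^-1 w = c *: P^-1 w], without inverting
    [c]; linearity of [A] and [Q] then pulls [c] out. *)
Lemma liso_conj_scale {R : comPzRingType} {V W : lmodType R} {c : R}
    {P A : liso V W} (Q : liso V V) :
  (forall v, P v = c *: A v) -> liso_conj P Q = liso_conj A Q.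
Proof.
move=> PA; apply: lisoP => w /=.
have [_ PK] := liso_invfunK P; have [AK _] := liso_invfunK A.
rewrite -{2}[w]PK !PA.
have -> : liso_invfun A (c *: A (liso_invfun P w)) = c *: liso_invfun P w.
  by rewrite -linearZ /= AK.
by rewrite !linearZ.
Qed.

Section DetForm.
Context {R : realType} {M : manifold R}.
Variable rho : volume_form M.

Lemma vol_scale {x} (c : R) (u v w : tangent x) :
  rho x (c *: u) (c *: v) (c *: w) = c ^+ 3 * rho x u v w.
Proof.
rewrite (scalar_scale c u (vol_linear1 rho _ _)).
rewrite (scalar_scale c v (vol_linear2 rho _ _)).
rewrite (scalar_scale c w (vol_linear3 rho _ _)).
by rewrite !mulrA -!expr2 -exprSr.
Qed.

(** Some triple at the source has nonzero volume, and its factor can be cancelled. *)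
Lemma det_form_unique (A : frame M) (d : R) :
  (forall v1 v2 v3, rho (target A) (A v1) (A v2) (A v3) =
                    d * rho (source A) v1 v2 v3) ->
  det_form rho A = d.
Proof.
move=> dA; apply: xget_unique => // d' d'A.
have [u [v [w uvw]]] := vol_nonzero rho (source A).
by apply: (mulIf uvw); rewrite -d'A dA.
Qed.

(** The default value of [det_form] is 0, so a nonzero value certifies that the defining equation
    holds. *)
Lemma det_formE (A : frame M) : det_form rho A != 0 ->
  forall v1 v2 v3, rho (target A) (A v1) (A v2) (A v3) =
                   det_form rho A * rho (source A) v1 v2 v3.
Proof.
move=> dA0; rewrite /det_form; case: xgetP => [d _ //|nd].
by move: dA0; rewrite /det_form xgetPN ?eqxx.
Qed.

Lemma tangent_nontrivial (x : M) : exists u : tangent x, u != 0.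
Proof.
have [u [v [w uvw]]] := vol_nonzero rho x; exists u.
apply: contra_neq uvw => ->.
by rewrite -[0](scale0r u) (scalar_scale 0 u (vol_linear1 rho _ _)) mul0r.
Qed.

(** Scaling by [c] multiplies the determinant [d] by [c ^+ 3], here the inverse of [|d|], which
    leaves the sign of [d]. *)
Lemma det_form_unimodular_scale {X Y : M} {A P : liso (tangent X) (tangent Y)} :
  (forall v, P v = (`|det_form rho (Frame A)| `^ (- 3^-1)) *: A v) ->
  det_form rho (Frame P) = -1 \/ det_form rho (Frame P) = 1.
Proof.
set d := det_form rho (Frame A); set c := _ `^ _ => PA.
(* At [d = 0] the factor [0 `^ (- 3^-1)] is [0], contradicting the injectivity
   of [P]; so [d] is a genuine determinant and not the default value. *)
have d0 : d != 0.
  have [u] := tangent_nontrivial X; apply: contra_neq => d0.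
  by apply: (bij_inj (liso_bij P)); rewrite linear0 PA /c d0 normr0 powR0 ?scale0r//.
have c3 : c ^+ 3 = `|d|^-1.
  rewrite -powR_mulrn ?powR_ge0// -powRrM mulNr mulVf ?pnatr_eq0//.
  by rewrite powR_inv1.
have -> : det_form rho (Frame P) = Num.sg d.
  apply: det_form_unique => v1 v2 v3 /=.
  rewrite !PA vol_scale (det_formE (Frame A) d0) -/d mulrA c3.
  by rewrite {2}[d]numEsg mulrCA mulVf ?mulr1// normr_eq0.
by case: sgrP d0 => //; [right | left].
Qed.

End DetForm.

Theorem proposition6p10 (R : realType) (B : body R) (S : Type)
    (sigma : constitutive_law B S) (rho : volume_form B)
    (hfluid : functionally_graded_fluid sigma)
    (hrho : material_form sigma rho)
    (hunisym : unisymmetric sigma) :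
  unimodular_reduction rho (material_groupoid sigma) =
  material_groupoid sigma `&` unimodular_groupoid rho.
Proof.
apply/seteqP; split=> -[X Y P].
  move=> [A /= NA PA]; split; last exact: det_form_unimodular_scale PA.
  (* [P] and [A] share source and target, so it is enough that they conjugate each symmetry
     alike. *)
  rewrite /material_groupoid /= NA /=; apply: eq_imagel => Q _ /=.
  by rewrite (liso_conj_scale _ PA).
move=> [NP UP]; exists P => //= v.
have -> : `|det_form rho (Frame P)| = 1.
  by case: UP => ->; rewrite ?normrN normr1.
by rewrite powR1 scale1r.
Qed.
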